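(* Let $q\in(1,\infty)$ and $A,B\in\mathbb{C}^{n\times n}$. Assume that $\mu\in\mathbb{C}$ with $\mathrm{Re}(\mu)\ge 1$ is such that $[\mu]_q\in\mathrm{spec}(B)$ and $[\mu+p]_q\notin\mathrm{spec}(B)$ for all integers $p\ge 1$. Let $s_{0,q}$ be an eigenvector of $B$ associated to the eigenvalue $[\mu]_q$. Then the formal power series $$y(z;q)=\sum_{p=0}^{\infty}s_{p,q}z^{p+\mu},\qquad s_{p,q}=\big([\mu+p]_qI-B\big)^{-1}As_{p-1,q}\quad(p\ge 1),$$ is the unique formal solution, in the form of a formal Floquet series $\sum_{p\ge 0}s_{p,q}z^{p+\mu}$ with the given $s_{0,q}$, of the $q$-hypergeometric system $$z\,D_qy(z;q)=(zA+B)y(z;q).$$ In addition, if $\|\cdot\|$ is a submultiplicative matrix norm and there exists $C>0$ such that $$\sup_{p\ge 1}\left\|\big([p+\mu]_qI-B\big)^{-1}\right\|\le C,$$ then this formal Floquet solution is convergent.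
   Context: For $q>1$ and $\omega\in\mathbb{C}$, $[\omega]_q:=\frac{q^{\omega}-1}{q-1}$ with $q^{\omega}=e^{\omega\ln q}$. The Jackson $q$-derivative is $D_qf(z)=\frac{f(qz)-f(z)}{qz-z}$; on formal series it acts termwise by $D_q\big(\sum_{p\ge 0}a_pz^{p+\mu}\big)=\sum_{p\ge 0}a_p[p+\mu]_q\,z^{p+\mu-1}$, and componentwise on vectors. It is the moment derivative associated with the moment function $m(z)=\Gamma_q(1+z)$ (where $\Gamma_q$ is the $q$-Gamma function), for which $m(p)=[p]_q!=[1]_q[2]_q\cdots[p]_q$ for nonnegative integers $p$ and $\frac{m(\omega)}{m(\omega-1)}=[\omega]_q$ for $\mathrm{Re}(\omega)\ge1$. The series $\sum_{p\ge 0}s_{p,q}z^{p+\mu}$ is called convergent if $\sum_{p\ge 0}s_{p,q}z^p$ has a positive radius of convergence. $\mathrm{spec}(B)$ is the set of eigenvalues of $B$; $I$ is the identity matrix. *)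

(* Defs.v *)
From mathcomp Require Import all_boot all_order all_algebra.
From mathcomp Require Export complex.
From mathcomp Require Import all_classical all_reals all_analysis.

Set Implicit Arguments.
Unset Strict Implicit.
Unset Printing Implicit Defensive.

Import Order.TTheory GRing.Theory Num.Theory.
Import numFieldNormedType.Exports.

Local Open Scope classical_set_scope.
Local Open Scope complex_scope.
Local Open Scope ring_scope.

Section QNumbers.
Variable R : realType.
Implicit Types (q : R) (w : R[i]).

(* e^(x + i y) = e^x (cos y + i sin y) *)
Definition cexp w : R[i] :=
  let: x +i* y := w in (expR x * cos y) +i* (expR x * sin y).

Definition qpow q w : R[i] := cexp (w * (ln q)%:C).

Definition qnum q w : R[i] := (qpow q w - 1) / (q%:C - 1).

End QNumbers.

(* A formal sum of complex powers of z is encoded by its coefficients: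
   [y w] is the coefficient of z^w. *)
Definition fseries (R : realType) (n : nat) := R[i] -> 'cV[R[i]]_n.

Section FormalSeries.
Variables (R : realType) (n : nat).
Implicit Types (q : R) (mu w : R[i]) (A B : 'M[R[i]]_n).
Implicit Types (s t : nat -> 'cV[R[i]]_n) (y : fseries R n).

(* sum_(p >= 0) s_p z^(p + mu); at most one p contributes to each z^w. *)
Definition floquet mu s : fseries R n :=
  fun w => \sum_(p \in [set p : nat | p%:R + mu = w]) s p.

Definition fs_mulz y : fseries R n := fun w => y (w - 1).

Definition fs_mulmx A y : fseries R n := fun w => A *m y w.

(* D_q z^w = [w]_q z^(w-1) *)
Definition fs_qderiv q y : fseries R n :=
  fun w => qnum q (w + 1) *: y (w + 1).

(* z D_q y = (z A + B) y *)
Definition qhypergeometric q A B y : Prop :=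
  fs_mulz (fs_qderiv q y) = fs_mulz (fs_mulmx A y) \+ fs_mulmx B y.

Definition floquet_solution q A B mu (s0 : 'cV[R[i]]_n) y : Prop :=
  (exists2 t, t 0%N = s0 & y = floquet mu t) /\ qhypergeometric q A B y.

Fixpoint floquet_coef q A B mu (s0 : 'cV[R[i]]_n) (p : nat) : 'cV[R[i]]_n :=
  if p is p'.+1 then
    invmx ((qnum q (mu + p%:R))%:M - B) *m A *m floquet_coef q A B mu s0 p'
  else s0.

Definition radius_of_convergence s : \bar R :=
  ereal_sup [set (Normc.normc z)%:E |
              z in [set z : R[i] | cvgn (series (fun p => z ^+ p *: s p))]].

(* Convergence of sum_(p >= 0) s_p z^(p + mu); it does not depend on mu. *)
Definition floquet_convergent s : Prop := (0 < radius_of_convergence s)%E.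

Definition submultiplicative_norm (N : 'M[R[i]]_n -> R) : Prop :=
  [/\ forall M, N M = 0 -> M = 0,
      forall (a : R[i]) M, N (a *: M) = Normc.normc a * N M,
      forall M M', N (M + M') <= N M + N M' &
      forall M M', N (M *m M') <= N M * N M'].

Lemma floquetE mu s p : floquet mu s (p%:R + mu) = s p.
Proof.
rewrite /floquet (_ : mkset _ = [set p]) ?fsbig_set1//.
apply/seteqP; split => k /= => [/addIr/eqP|-> //].
by rewrite eqr_nat => /eqP.
Qed.

Lemma floquet_out mu s w :
  (forall p : nat, p%:R + mu <> w) -> floquet mu s w = 0.
Proof.
move=> h; rewrite /floquet (_ : mkset _ = set0) ?fsbig_set0//.
by apply/seteqP; split => k //= /h.
Qed.

Lemma fs_qderiv_floquet q mu s :
  fs_qderiv q (floquet mu s) =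
  floquet (mu - 1) (fun p => qnum q (p%:R + mu) *: s p).
Proof.
apply/funext => w; rewrite /fs_qderiv.
have [[p pw]|h] := pselect (exists p : nat, p%:R + mu = w + 1).
  have -> : w = p%:R + (mu - 1) by rewrite addrA pw addrK.
  by rewrite floquetE addrA subrK floquetE.
rewrite !floquet_out ?scaler0// => p pw; apply: h; exists p => //.
by rewrite -pw addrA subrK.
Qed.

End FormalSeries.

(* [eigenvalue] is stated with row eigenvectors; the spectrum is the same as
   for column eigenvectors. *)
Lemma eigenvalue_colP (F : fieldType) (n : nat) (B : 'M[F]_n) (a : F) :
  reflect (exists2 v : 'cV[F]_n, v != 0 & B *m v = a *: v) (eigenvalue B a).
Proof.
have -> : eigenvalue B a = eigenvalue B^T a.
  rewrite /eigenvalue /eigenspace !kermx_eq0 !row_free_unit -unitmx_tr.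
  by rewrite linearB/= tr_scalar_mx.
apply: (iffP eigenvalueP) => -[v].
  move=> vB v0; exists v^T; first by rewrite trmx_eq0.
  by rewrite -[B]trmxK -trmx_mul vB linearZ.
by move=> v0 vB; exists v^T; rewrite ?trmx_eq0// -trmx_mul vB linearZ.
Qed.

(* Main.v *)
Require Import Defs.
From mathcomp Require Import all_boot all_order all_algebra.
From mathcomp Require Import all_classical all_reals all_analysis.
Import Order.TTheory GRing.Theory Num.Theory.
Import numFieldNormedType.Exports.
Local Open Scope classical_set_scope.
Local Open Scope complex_scope.
Local Open Scope ring_scope.

(** Since z D_q z^w = [w]_q z^w, comparing the coefficients of z^(p + mu) in
    the equation turns it into
      B s_0 = [mu]_q s_0   and   ([mu + p]_q I - B) s_p = A s_(p-1), p >= 1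
    ([qhypergeometric_floquetP]). The first relation is the eigenvector
    hypothesis. As [mu + p]_q avoids the spectrum of B for p >= 1, each matrix
    [mu + p]_q I - B is invertible, so the second relation is exactly the
    recursion that defines s_p, and by induction it has one solution
    ([resolvent_eqP]).

    For the convergence, a bound C on the norms of the resolvents and
    submultiplicativity give a geometric growth, of ratio D = C N(A)
    ([floquet_coef_growth]). The norm N measures square matrices only, so
    columns are measured through rank-one matrices s_p v, with v a row; it
    controls the individual entries ([submultiplicative_norm_entry]), hence
    those of s_p are O(D^p), and the series converges at the positive real
    point 1 / (D + 1) by comparison with a geometric series
    ([floquet_convergent_geometric]). *)

Lemma resolvent_eqP (F : fieldType) (n : nat) (B : 'M[F]_n) (a : F)
    (u v : 'cV[F]_n) :
  ~~ eigenvalue B a ->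
  a *: v = u + B *m v <-> v = invmx (a%:M - B) *m u.
Proof.
rewrite negbK /eigenspace kermx_eq0 row_free_unit => aB.
have {}aB : a%:M - B \in unitmx.
  by rewrite -opprB -scaleN1r unitmxZ ?unitrN1.
split=> [e|->].
  by rewrite -(mulKmx aB v) mulmxBl mul_scalar_mx e addrK.
by rewrite -{2}(mulKVmx aB u) mulmxBl mul_scalar_mx subrK.
Qed.

(** The bottom of the recursion: no exponent p + mu equals mu - 1, so the term
    z A y does not contribute to the coefficient of z^mu. *)
Lemma floquet_below (R : realType) (n : nat) (mu : R[i])
    (t : nat -> 'cV[R[i]]_n) : floquet mu t (mu - 1) = 0.
Proof.
apply: floquet_out => p; rewrite addrC => /addrI /eqP.
by rewrite -subr_eq0 opprK natr1 pnatr_eq0.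
Qed.

(** Both sides of the equation are supported on the exponents p + mu, where
    they can be compared one coefficient at a time. *)
Lemma qhypergeometric_floquetP (R : realType) (q : R) (n : nat)
    (A B : 'M[R[i]]_n) (mu : R[i]) (t : nat -> 'cV[R[i]]_n) :
  qhypergeometric q A B (floquet mu t) <->
  B *m t 0%N = qnum q mu *: t 0%N /\
  forall p, qnum q (mu + p.+1%:R) *: t p.+1 = A *m t p + B *m t p.+1.
Proof.
have lhsE w :
    fs_mulz (fs_qderiv q (floquet mu t)) w = qnum q w *: floquet mu t w.
  by rewrite /fs_mulz /fs_qderiv subrK.
have shiftE p : p.+1%:R + mu - 1 = p%:R + mu.
  by rewrite -natr1 addrAC addrK.
split=> [eq_y|[eq0 eqS]]; last first.
  apply/funext => w; rewrite lhsE /= /fs_mulz /fs_mulmx.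
  have [[[|p] <-]|w_out] := pselect (exists p : nat, p%:R + mu = w).
  - by rewrite floquetE add0r floquet_below mulmx0 add0r eq0.
  - by rewrite shiftE !floquetE addrC eqS.
  - rewrite !floquet_out ?mulmx0 ?scaler0 ?addr0// => p pw; apply: w_out.
      by exists p.+1; rewrite -[LHS](subrK 1) shiftE pw subrK.
    by exists p.
have eq_at w : qnum q w *: floquet mu t w =
    A *m floquet mu t (w - 1) + B *m floquet mu t w.
  by rewrite -lhsE eq_y.
split=> [|p].
  have := eq_at (0%:R + mu).
  by rewrite floquetE add0r floquet_below mulmx0 add0r.
by have := eq_at (p.+1%:R + mu); rewrite shiftE !floquetE addrC.
Qed.

Lemma submultiplicative_norm_ge0 (R : realType) (n : nat)
    (N : 'M[R[i]]_n -> R) (M : 'M[R[i]]_n) :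
  submultiplicative_norm N -> 0 <= N M.
Proof.
case=> _ NZ ND _.
have := ND M (- 1 *: M).
have N0 : N 0 = 0 by rewrite -(scale0r 0) NZ Normc.normc0 mul0r.
by rewrite NZ normcN Normc.normc1 mul1r scaleN1r subrr N0 -mulr2n pmulrn_lge0.
Qed.

(** Pinching M between matrix units isolates an entry:
    E_ii M E_jj = M_ij E_ij. Submultiplicativity then bounds M_ij by N(M),
    without appealing to the equivalence of norms in finite dimension. *)
Lemma submultiplicative_norm_entry (R : realType) (n : nat)
    (N : 'M[R[i]]_n -> R) (i j : 'I_n) :
  submultiplicative_norm N ->
  exists2 K : R, 0 <= K & forall M : 'M[R[i]]_n, Normc.normc (M i j) <= K * N M.
Proof.
move=> hN; have N_ge0 M : 0 <= N M by exact: submultiplicative_norm_ge0.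
case: (hN) => N_eq0 NZ _ NM.
pose E (k l : 'I_n) : 'M[R[i]]_n := delta_mx k l.
have Eij_gt0 : 0 < N (E i j).
  rewrite lt0r N_ge0 andbT; apply/eqP => /N_eq0 /matrixP/(_ i j)/eqP.
  by rewrite !mxE !eqxx oner_eq0.
exists (N (E i i) * N (E j j) / N (E i j)).
  by rewrite divr_ge0 ?mulr_ge0.
move=> M; rewrite mulrAC ler_pdivlMr// -NZ.
have -> : M i j *: E i j = E i i *m M *m E j j.
  apply/matrixP => k l; rewrite /E !mxE (bigD1 j)//= big1 ?addr0; last first.
    by move=> x xj; rewrite [delta_mx _ _ _ _]mxE (negPf xj)/= mulr0.
  rewrite !mxE (bigD1 i)//= big1 ?addr0; last first.
    by move=> x xi; rewrite !mxE (negPf xi) andbF mul0r.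
  by rewrite !mxE !eqxx andbT /=; case: (k == i); case: (l == j);
    rewrite ?mulr1 ?mul1r ?mulr0 ?mul0r.
apply: le_trans (NM _ _) _; rewrite [leRHS]mulrAC ler_wpM2r//.
Qed.

(** The cast to [numFieldType] selects the topology of the modulus on R[i], the
    one from which matrices with complex entries inherit theirs. *)
Lemma cvg_complex (R : realType) (x y : nat -> R) (a b : R) :
  x @ \oo --> a -> y @ \oo --> b ->
  (fun k => x k +i* y k : (R[i] : numFieldType)) @ \oo -->
    (a +i* b : (R[i] : numFieldType)).
Proof.
have cvgC (u : nat -> R) (c : R) : u @ \oo --> c ->
    (fun k => (u k)%:C : (R[i] : numFieldType)) @ \oo -->
      (c%:C : (R[i] : numFieldType)).
  (* A positive element of R[i] is real, so radii in R[i] are radii in R. *)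
  move=> /cvgrPdist_lt uc; apply/cvgrPdist_lt => -[e e'].
  rewrite ltcE /= => /andP[/eqP -> e0].
  near=> k; rewrite -rmorphB normc_def /= expr0n addr0 sqrtr_sqr ltcR.
  near: k; exact: uc.
move=> xa yb.
rewrite [a +i* b]complexE /=.
under eq_fun do rewrite [_ +i* _]complexE /=.
pose K : numFieldType := R[i].
apply: (@cvgD K K _ _ _ (fun k => (x k)%:C : K)); first exact: cvgC.
by apply: (@cvgM K _ _ _ (fun=> 'i : K)); [exact: cvg_cst|exact: cvgC].
Unshelve. all: by end_near. Qed.

Lemma cvg_mx (K : numFieldType) (m n : nat) (s : nat -> 'M[K]_(m, n))
    (l : 'M[K]_(m, n)) :
  (forall i j, s k i j @[k --> \oo] --> l i j) -> s @ \oo --> l.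
Proof.
move=> sl; apply/cvg_ballP => e e0.
near=> k; split=> // i j; move: i j.
near: k; apply: filter_forall => i; apply: filter_forall => j.
by have /cvg_ballP := sl i j; apply.
Unshelve. all: by end_near. Qed.

(** Comparison test. Completeness is only used over the reals: the real and
    imaginary parts of every entry form absolutely convergent real series. *)
Lemma is_cvg_series_mx_dominated (R : realType) (m n : nat)
    (t : nat -> 'M[R[i] : numFieldType]_(m, n)) (a : 'I_m -> 'I_n -> nat -> R) :
  (forall i j, cvgn (series (a i j))) ->
  (forall p i j, Normc.normc (t p i j) <= a i j p) ->
  cvgn (series t).
Proof.
move=> cvg_a le_ta.
have cvg_part (f : R[i] -> R) : (forall z, `|f z| <= Normc.normc z) ->
    forall i j, cvgn (series (fun p => f (t p i j))).
  move=> fle i j; apply: normed_cvg; apply: series_le_cvg (cvg_a i j) => p //=.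
    exact: le_trans (normr_ge0 _) (le_trans (fle _) (le_ta p i j)).
  exact: le_trans (fle _) (le_ta p i j).
have cvgRe : forall i j, cvgn (series (fun p => complex.Re (t p i j))).
  apply: cvg_part => -[x y]; rewrite /= -sqrtr_sqr ler_wsqrtr//.
  by rewrite lerDl sqr_ge0.
have cvgIm : forall i j, cvgn (series (fun p => complex.Im (t p i j))).
  apply: cvg_part => -[x y]; rewrite /= -sqrtr_sqr ler_wsqrtr//.
  by rewrite lerDr sqr_ge0.
apply/cvg_ex; exists (\matrix_(i, j)
  (limn (series (fun p => complex.Re (t p i j))) +i*
   limn (series (fun p => complex.Im (t p i j))))).
apply: cvg_mx => i j; rewrite mxE.
have -> : (fun k => series t k i j) = (fun k =>
    series (fun p => complex.Re (t p i j)) k +i*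
    series (fun p => complex.Im (t p i j)) k).
  apply/funext => k; rewrite /series /= summxE; elim/big_ind3: _ => //.
    by move=> ? x y ? x' y' -> ->.
  by move=> p _; case: (t p i j).
by apply: cvg_complex; [exact: cvgRe|exact: cvgIm].
Qed.

(** The constant may depend on the entry, which avoids taking a maximum over
    the indices. The point 1 / (D + 1) is positive, also when D = 0, and there
    the ratio D / (D + 1) of the dominating geometric series is below 1. *)
Lemma floquet_convergent_geometric (R : realType) (n : nat)
    (s : nat -> 'cV[R[i]]_n) (D : R) (K : 'I_n -> R) : 0 <= D ->
  (forall p i, Normc.normc (s p i 0) <= K i * D ^+ p) ->
  floquet_convergent s.
Proof.
move=> D0 le_s; pose r := (D + 1)^-1.
have D1_gt0 : 0 < D + 1 by rewrite ltr_wpDl.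
have r_gt0 : 0 < r by rewrite invr_gt0.
have normr_r : Normc.normc r%:C = r.
  by rewrite /= expr0n addr0 sqrtr_sqr gtr0_norm.
apply: (@lt_le_trans _ _ r%:E); first by rewrite lte_fin.
apply: ereal_sup_ubound; exists r%:C; last by rewrite normr_r.
apply: (@is_cvg_series_mx_dominated _ _ _ _
  (fun i _ => geometric (K i) (r * D))) => [i _|p i j].
  apply: is_cvg_geometric_series.
  rewrite ger0_norm ?mulr_ge0 ?(ltW r_gt0)//.
  by rewrite mulrC ltr_pdivrMr// mul1r ltrDl.
rewrite mxE Normc.normcM ord1 /= exprMn mulrCA.
have -> : Normc.normc (r%:C ^+ p) = r ^+ p.
  elim: p => [|p IH]; first exact: Normc.normc1.
  by rewrite !exprS Normc.normcM IH normr_r.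
by rewrite ler_wpM2l// exprn_ge0// ltW.
Qed.

(** Multiplying by a fixed row v on the right makes the column s_p a square
    matrix, to which N applies, and commutes with the recursion, which acts on
    the left. *)
Lemma floquet_coef_growth (R : realType) (q : R) (n : nat)
    (A B : 'M[R[i]]_n) (mu : R[i]) (s0 : 'cV[R[i]]_n)
    (N : 'M[R[i]]_n -> R) (C : R) (v : 'rV[R[i]]_n) :
  submultiplicative_norm N ->
  (forall p : nat, (1 <= p)%N ->
     N (invmx ((qnum q (mu + p%:R))%:M - B)) <= C) ->
  forall p, N (floquet_coef q A B mu s0 p *m v) <=
    N (s0 *m v) * (C * N A) ^+ p.
Proof.
move=> hN hC; have N_ge0 M : 0 <= N M by exact: submultiplicative_norm_ge0.
case: (hN) => _ _ _ NM; have C_ge0 : 0 <= C := le_trans (N_ge0 _) (hC 1 isT).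
elim=> [|p IH]; first by rewrite mulr1.
rewrite [floquet_coef _ _ _ _ _ _]/= -!mulmxA.
apply: le_trans (NM _ _) _; rewrite exprS mulrCA -mulrA.
apply: ler_pM => //; first exact: hC.
by apply: le_trans (NM _ _) _; rewrite ler_wpM2l.
Qed.

Theorem corollary3p3 (R : realType) (q : R) (hq : 1 < q) (n : nat)
    (A B : 'M[R[i]]_n) (mu : R[i]) (hmu : 1 <= complex.Re mu)
    (hspec : eigenvalue B (qnum q mu))
    (hres : forall p : nat, (1 <= p)%N -> ~~ eigenvalue B (qnum q (mu + p%:R)))
    (s0 : 'cV[R[i]]_n) (hs0 : s0 != 0) (hBs0 : B *m s0 = qnum q mu *: s0) :
  let s := floquet_coef q A B mu s0 in
  let y := floquet mu s in
  [/\ floquet_solution q A B mu s0 y,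
      forall y', floquet_solution q A B mu s0 y' -> y' = y &
      forall N : 'M[R[i]]_n -> R, submultiplicative_norm N ->
        (exists2 C : R, 0 < C &
           (ereal_sup [set (N (invmx ((qnum q (p%:R + mu))%:M - B)))%:E
                       | p in [set p : nat | (1 <= p)%N]] <= C%:E)%E) ->
        floquet_convergent s].
Proof.
move=> s y.
split=> [|_ [[t t0 ->] /qhypergeometric_floquetP[_ rec_t]]|N hN [C C_gt0 supC]].
- split; first by exists s.
  apply/qhypergeometric_floquetP; split=> // p.
  by apply/(resolvent_eqP _ _ _ _ _ _ (hres p.+1 isT)); rewrite mulmxA.
- congr (floquet mu); apply/funext; elim=> [//|p IH].
  have /(resolvent_eqP _ _ _ _ _ _ (hres p.+1 isT)) -> := rec_t p.
  by rewrite IH mulmxA.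
have hC p : (1 <= p)%N -> N (invmx ((qnum q (mu + p%:R))%:M - B)) <= C.
  move=> p1; rewrite -lee_fin; apply: le_trans supC.
  by apply: ereal_sup_ubound; exists p => //; rewrite [mu + _]addrC.
have /choice[K hK] i : exists K : R,
    0 <= K /\ forall M : 'M[R[i]]_n, Normc.normc (M i i) <= K * N M.
  by have [K K_ge0 hK] := submultiplicative_norm_entry R n N i i hN; exists K.
have CA_ge0 : 0 <= C * N A.
  by rewrite mulr_ge0 ?(ltW C_gt0) ?submultiplicative_norm_ge0.
apply: (floquet_convergent_geometric _ _ _ _
  (fun i => K i * N (s0 *m delta_mx 0 i)) CA_ge0) => p i.
(* For v the i-th unit row, the (i, i) entry of s_p v is the i-th entry of s_p. *)
have [K_ge0 /(_ (s p *m delta_mx 0 i))] := hK i.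
rewrite mxE big_ord1 mxE !eqxx mulr1 => /le_trans; apply.
by rewrite -mulrA ler_wpM2l// floquet_coef_growth.
Qed.
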